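(* Let $k=k_p$, $N_T=N_{T,p}$, $m=m_p$, $N_S=N_{S,p}$ be positive integers and $\delta_p\in(0,1)$ such that, as $p\to\infty$, $$\frac kp\to\vartheta,\quad (p-k)\delta_p\to\eta,\quad \frac{N_T}p\to\rho_T,\quad \frac mp\to\rho_m,\quad \frac{N_S}p\to\rho_S,$$ where $\vartheta,\rho_T\in(0,1)$, $\eta\in(0,\infty)$, $\rho_m,\rho_S\in(0,\infty)$, and $\rho_T\ne\vartheta$, $\rho_m\neq\rho_S$, $\rho_m,\rho_S\ne\vartheta$, $\rho_m,\rho_S\neq1$. Let $\mathsf{W2SG}_p^{\mathrm{DE}}$ be the master deterministic-equivalent gain defined in the context, and define $$\Lambda_T:=\begin{cases}\vartheta-\rho_T,&\rho_T<\vartheta,\\ \dfrac{(1-\vartheta)(\rho_T-\vartheta)}{1-\rho_T},&\rho_T>\vartheta.\end{cases}$$ Below, ''$\mathsf{W2SG}_p^{\mathrm{DE}}>0$'' and ''$\mathsf{W2SG}_p^{\mathrm{DE}}<0$'' mean that the inequality holds for all sufficiently large $p$. (i) (Necessary condition.) If $\min\{\rho_m,\rho_S\}<\vartheta$, then $\mathsf{W2SG}_p^{\mathrm{DE}}<0$. (ii) (Sample-bottleneck regime.) Suppose $\vartheta<\rho_m<\min\{1,\rho_S\}$. Let $\Delta_{\mathrm{DE}}:=(\rho_S+3\vartheta-\Lambda_T)^2-16\vartheta\rho_S$. If $\Delta_{\mathrm{DE}}>0$, then $$\mathsf{W2SG}_p^{\mathrm{DE}}>0\iff\rho_m\in\left(\frac{\rho_S+3\vartheta-\Lambda_T-\sqrt{\Delta_{\mathrm{DE}}}}4,\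 \frac{\rho_S+3\vartheta-\Lambda_T+\sqrt{\Delta_{\mathrm{DE}}}}4\right)\cap(\vartheta,\min\{1,\rho_S\}).$$ If $\Delta_{\mathrm{DE}}\le0$, there is no positive region on this branch, i.e. $\mathsf{W2SG}_p^{\mathrm{DE}}>0$ holds for no $\rho_m\in(\vartheta,\min\{1,\rho_S\})$. (iii) (Feature-bottleneck regime.) Suppose $\vartheta<\rho_S<\min\{1,\rho_m\}$. Then $$\mathsf{W2SG}_p^{\mathrm{DE}}>0\iff \rho_S-\vartheta>\Lambda_T\ \text{ and }\ \rho_m>\frac{2\rho_S(\rho_S-\vartheta)}{\rho_S-\vartheta-\Lambda_T}.$$
   Context: **Master deterministic-equivalent gain.** (It is the deterministic equivalent of teacher risk minus student risk in a two-stage linear random-feature model with input covariance $\operatorname{diag}(I_k,\delta_pI_{p-k})$, unit-norm target supported on the first $k$ coordinates, $N_T$ teacher features, $N_S$ student features and $m$ teacher-labeled samples.) For $\tau\ge0$ put $$\operatorname{df}_p(\tau)=\frac1p\left[\frac k{1+\tau}+\frac{(p-k)\delta_p}{\delta_p+\tau}\right],\quad \operatorname{df}^{(2)}_p(\tau)=\frac1p\left[\frac k{(1+\tau)^2}+\frac{(p-k)\delta_p^2}{(\delta_p+\tau)^2}\right],\quad \Delta_p(\tau)=\frac1{\delta_p+\tau}-\frac1{1+\tau}.$$ *Teacher.* For $N_T<p$ let $\tau_T>0$ be the unique solution of $\operatorname{df}_p(\tau_T)=N_T/p$ ($\tau_T=0$ if $N_T\ge p$). Put $a=\frac1{1+\tau_T}$,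 $c=a-a^2$, $\Theta=\left[1+\frac{k(\delta_p+\tau_T)^2}{(p-k)\delta_p(1+\tau_T)^2}\right]^{-1}$, $V=c\,\Theta$, $S=a-c\,\Theta$. *Student.* If $p<\min\{m,N_S\}$ set $\tau_S=0$; if $N_S<\min\{m,p\}$ let $\tau_S>0$ be the unique solution of $\operatorname{df}_p(\tau_S)=N_S/p$; if $m<\min\{p,N_S\}$ let $\tau_S>0$ be the unique solution of $\operatorname{df}_p(\tau_S)=m/p$. Put $\mathcal T^{(1)}(\tau)=\frac S{1+\tau}+\frac V{\delta_p+\tau}$, $\mathcal T^{(2)}(\tau)=\frac S{(1+\tau)^2}+\frac V{(\delta_p+\tau)^2}$ and $$\mathcal M=\begin{cases}0,&p<\min\{m,N_S\},\\[1mm] \dfrac{\tau_S\mathcal T^{(1)}(\tau_S)}{1-N_S/m},&N_S<\min\{m,p\},\\[3mm] \dfrac{\tau_S^2\mathcal T^{(2)}(\tau_S)}{1-(p/m)\operatorname{df}_p^{(2)}(\tau_S)}+\dfrac{\tau_S\mathcal T^{(1)}(\tau_S)(m/N_S)}{1-m/N_S},&m<\min\{p,N_S\}.\end{cases}$$ Then $\mathsf{W2SG}_p^{\mathrm{DE}}:=2\tau_SV\Delta_p(\tau_S)-\mathcal M$.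
   Formalization: For one fixed family the criteria in (ii), (iii) can fail when ρ_m is an interval endpoint, the double root (Δ_DE=0), or the critical value; there the formal theorem reads ''W2SG>0'' as holding for every family with these limits, and claims the per-family version only elsewhere. *)

(* Defs.v *)
From HB Require Import structures.
From mathcomp Require Import all_boot all_order all_algebra.
From mathcomp Require Import all_classical all_reals all_analysis.
Set Implicit Arguments.
Unset Strict Implicit.
Unset Printing Implicit Defensive.
Import Order.TTheory GRing.Theory Num.Theory.
Import numFieldNormedType.Exports.
Local Open Scope classical_set_scope.
Local Open Scope ring_scope.

Section MasterGain.
Context {R : realType}.
Implicit Types (p k N NT NS m : nat) (delta tau : R).

Definition df p k delta tau : R :=
  p%:R^-1 * (k%:R / (1 + tau) + (p%:R - k%:R) * delta / (delta + tau)).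

Definition df2 p k delta tau : R :=
  p%:R^-1 * (k%:R / (1 + tau) ^+ 2
             + (p%:R - k%:R) * delta ^+ 2 / (delta + tau) ^+ 2).

Definition Delta delta tau : R := (delta + tau)^-1 - (1 + tau)^-1.

(* For 0 < N < p, k < p and 0 < delta the solution exists and is unique, df
   being strictly decreasing from 1 at tau = 0 to 0 at infinity; the default
   value 0 is returned when there is no solution. *)
Definition df_root p k delta N : R :=
  xget 0 [set tau | 0 < tau /\ df p k delta tau = N%:R / p%:R].

Definition tauT p k delta NT : R :=
  if (NT < p)%N then df_root p k delta NT else 0.

Definition coefa p k delta NT : R := (1 + tauT p k delta NT)^-1.

Definition coefc p k delta NT : R :=
  coefa p k delta NT - coefa p k delta NT ^+ 2.

Definition coefTheta p k delta NT : R :=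
  let t := tauT p k delta NT in
  (1 + k%:R * (delta + t) ^+ 2
       / ((p%:R - k%:R) * delta * (1 + t) ^+ 2))^-1.

Definition coefV p k delta NT : R :=
  coefc p k delta NT * coefTheta p k delta NT.

Definition coefS p k delta NT : R :=
  coefa p k delta NT - coefc p k delta NT * coefTheta p k delta NT.

(* In tauS and penalty the last branch collects the ties (for instance
   m = NS < p), where the quantities are not defined; they do not occur for
   large p when the limit ratios rhom, rhoS and 1 are pairwise distinct. *)
Definition tauS p k delta m NS : R :=
  if (p < minn m NS)%N then 0
  else if (NS < minn m p)%N then df_root p k delta NS
  else if (m < minn p NS)%N then df_root p k delta m
  else 0.

Definition T1 p k delta NT tau : R :=
  coefS p k delta NT / (1 + tau) + coefV p k delta NT / (delta + tau).

Definition T2 p k delta NT tau : R :=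
  coefS p k delta NT / (1 + tau) ^+ 2
  + coefV p k delta NT / (delta + tau) ^+ 2.

Definition penalty p k delta NT m NS : R :=
  let t := tauS p k delta m NS in
  if (p < minn m NS)%N then 0
  else if (NS < minn m p)%N then
    t * T1 p k delta NT t / (1 - NS%:R / m%:R)
  else if (m < minn p NS)%N then
    t ^+ 2 * T2 p k delta NT t / (1 - p%:R / m%:R * df2 p k delta t)
    + t * T1 p k delta NT t * (m%:R / NS%:R) / (1 - m%:R / NS%:R)
  else 0.

Definition W2SG p k delta NT m NS : R :=
  let t := tauS p k delta m NS in
  2 * t * coefV p k delta NT * Delta delta t - penalty p k delta NT m NS.

End MasterGain.

Record model_seq (R : realType) := ModelSeq {
  seq_k : nat -> nat;
  seq_NT : nat -> nat;
  seq_m : nat -> nat;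
  seq_NS : nat -> nat;
  seq_delta : nat -> R }.

Section Regime.
Context {R : realType}.
Implicit Types (s : model_seq R) (vartheta eta rhoT rhom rhoS : R).

Definition gain s (p : nat) : R :=
  W2SG p (seq_k s p) (seq_delta s p) (seq_NT s p) (seq_m s p) (seq_NS s p).

Definition admissible vartheta eta rhoT rhom rhoS s : Prop :=
  (forall p, [/\ (0 < seq_k s p)%N, (0 < seq_NT s p)%N,
                 (0 < seq_m s p)%N & (0 < seq_NS s p)%N])
  /\ (forall p, 0 < seq_delta s p < 1)
  /\ [/\ (seq_k s p)%:R / p%:R @[p --> \oo] --> vartheta,
         (p%:R - (seq_k s p)%:R) * seq_delta s p @[p --> \oo] --> eta,
         (seq_NT s p)%:R / p%:R @[p --> \oo] --> rhoT,
         (seq_m s p)%:R / p%:R @[p --> \oo] --> rhom &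
         (seq_NS s p)%:R / p%:R @[p --> \oo] --> rhoS].

Definition eventually_pos s : Prop := \forall p \near \oo, 0 < gain s p.
Definition eventually_neg s : Prop := \forall p \near \oo, gain s p < 0.

(* Positivity as a property of the limit ratios.  It quantifies over all
   sequences with these limits because, where the first-order limit of the gain
   vanishes, the sign depends on how fast the ratios converge. *)
Definition gain_pos vartheta eta rhoT rhom rhoS : Prop :=
  forall s, admissible vartheta eta rhoT rhom rhoS s -> eventually_pos s.

Definition LambdaT vartheta rhoT : R :=
  if rhoT < vartheta then vartheta - rhoT
  else (1 - vartheta) * (rhoT - vartheta) / (1 - rhoT).

Definition linDE vartheta rhoT rhoS : R :=
  rhoS + 3 * vartheta - LambdaT vartheta rhoT.

Definition DeltaDE vartheta rhoT rhoS : R :=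
  linDE vartheta rhoT rhoS ^+ 2 - 16 * vartheta * rhoS.

Definition rhom_lo vartheta rhoT rhoS : R :=
  (linDE vartheta rhoT rhoS - Num.sqrt (DeltaDE vartheta rhoT rhoS)) / 4.

Definition rhom_hi vartheta rhoT rhoS : R :=
  (linDE vartheta rhoT rhoS + Num.sqrt (DeltaDE vartheta rhoT rhoS)) / 4.

Definition rhom_crit vartheta rhoT rhoS : R :=
  2 * rhoS * (rhoS - vartheta) / (rhoS - vartheta - LambdaT vartheta rhoT).

End Regime.

(* Main.v *)
(* The equation [df tau = N / p] is quadratic in [tau], so its positive root has
   a closed form, and with [rho = lim N / p] two scales appear:
   [tau --> vartheta / rho - 1] when [rho < vartheta], whereas
   [tau / delta --> (1 - rho) / (rho - vartheta)] when [vartheta < rho < 1].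
   On the teacher side [p * V] and [S] have positive limits [v], [s] with
   [v * Lambda_T = s * eta]; this is where [Lambda_T] comes from.
   If the student bottleneck is below [vartheta], the penalty keeps a positive
   limit while [tau * V * Delta --> 0].  If it lies in (vartheta, 1), then
   [p * gain] converges to a positive multiple of
   [linDE * rhom - 2 * rhom ^ 2 - 2 * vartheta * rhoS] (sample bottleneck) or of
   [(rhoS - vartheta - Lambda_T) * rhom - 2 * rhoS * (rhoS - vartheta)]
   (feature bottleneck), whose signs are the stated conditions.  Where such a
   limit vanishes, [gain_pos] is refuted by a diagonal sequence approximating
   [rhom] through ratios at which the limit is negative. *)
Require Import Defs.
From HB Require Import structures.
From mathcomp Require Import all_boot all_order all_algebra.
From mathcomp Require Import all_classical all_reals all_analysis.
From mathcomp Require Import ring lra.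
Import Order.TTheory GRing.Theory Num.Theory.
Import numFieldNormedType.Exports.
Local Open Scope classical_set_scope.
Local Open Scope ring_scope.

(** * Convergence of real sequences *)

(* A constant head for convergence, so that [lim] can recognise the shape of the
   sequence syntactically instead of by unification. *)
Definition tends {R : realType} (u : nat -> R) (a : R) : Prop :=
  u p @[p --> \oo] --> a.

Lemma tends_cst (R : realType) (c : R) : tends (fun=> c) c.
Proof. exact: cvg_cst. Qed.

Lemma tendsD (R : realType) (u v : nat -> R) (a b : R) :
  tends u a -> tends v b -> tends (fun p => u p + v p) (a + b).
Proof. exact: cvgD. Qed.

Lemma tendsN (R : realType) (u : nat -> R) (a : R) :
  tends u a -> tends (fun p => - u p) (- a).
Proof. exact: cvgN. Qed.

Lemma tendsM (R : realType) (u v : nat -> R) (a b : R) :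
  tends u a -> tends v b -> tends (fun p => u p * v p) (a * b).
Proof. exact: cvgM. Qed.

Lemma tendsV (R : realType) (u : nat -> R) (a : R) :
  a != 0 -> tends u a -> tends (fun p => (u p)^-1) a^-1.
Proof. exact: cvgV. Qed.

Lemma tendsX (R : realType) (u : nat -> R) (a : R) (n : nat) :
  tends u a -> tends (fun p => u p ^+ n) (a ^+ n).
Proof.
move=> ua; elim: n => [|n IHn]; first exact: tends_cst.
rewrite exprS (_ : (fun p => _) = fun p => u p * u p ^+ n); last first.
  by apply/funext => p; rewrite exprS.
exact: tendsM.
Qed.

(** Follows the syntax of the sequence, leaving the nonvanishing conditions of [tendsV] as side
    goals. The limit may be an existential variable, computed here and compared with the announced
    value afterwards, which is why [tends_eq] and [tends_near_eq] separate [a] from [b]. *)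
Ltac lim := repeat match goal with
  | H : tends ?u _ |- tends ?v _ => constr_eq u v; exact H
  | H : tends ?u _ |- tends (fun p => ?v p) _ => constr_eq u v; exact H
  | |- tends (fun p => ?c) _ => exact (tends_cst _ c)
  | |- tends (fun p => @?u p + @?v p) _ => refine (tendsD _ u v _ _ _ _)
  | |- tends (fun p => - @?u p) _ => refine (tendsN _ u _ _)
  | |- tends (fun p => @?u p ^+ ?n) _ => refine (tendsX _ u _ n _)
  | |- tends (fun p => @?u p * @?v p) _ => refine (tendsM _ u v _ _ _ _)
  | |- tends (fun p => (@?u p)^-1) _ => refine (tendsV _ u _ _ _)
  end.

Lemma tends_eq (R : realType) (u : nat -> R) (a b : R) :
  tends u a -> a = b -> tends u b.
Proof. by move=> ? <-. Qed.

Lemma tends_near_eq (R : realType) (u v : nat -> R) (a b : R) :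
  tends u a -> a = b -> (\forall p \near \oo, u p = v p) -> tends v b.
Proof.
move=> ua <- uv; apply: cvg_trans ua; apply: near_eq_cvg.
by apply: filterS uv => p.
Qed.

Lemma tends_near_eqr (R : realType) (u v : nat -> R) (a b : R) :
  (\forall p \near \oo, v p = u p) -> tends u a -> a = b -> tends v b.
Proof.
by move=> uv ua ab; apply: tends_near_eq ua ab _; apply: filterS uv => p ->.
Qed.

Lemma near_nat_gt0 (R : realType) : \forall p \near \oo, 0 < p%:R :> R.
Proof. by exists 1%N => // p /= p1; rewrite ltr0n. Qed.

Lemma tends_natV (R : realType) : tends (fun p => p%:R^-1 : R) 0.
Proof. by rewrite /tends -cvg_shiftS; exact: cvg_harmonic. Qed.

Lemma tends_nat_ratio1 (R : realType) : tends (fun p => p%:R / p%:R : R) 1.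
Proof.
apply: (@tends_near_eq _ (fun=> 1) _ 1) => //; first exact: cvg_cst.
by apply: filterS (near_nat_gt0 R) => p p0; rewrite divff // gt_eqF.
Qed.

(** Selects the branches of [tauT], [tauS] and [penalty] for large [p]; comparison with [p] itself
    is the instance [id], of ratio 1. *)
Lemma near_ltn_ratio (R : realType) (M N : nat -> nat) (a b : R) :
  tends (fun p => (M p)%:R / p%:R) a -> tends (fun p => (N p)%:R / p%:R) b ->
  a < b -> \forall p \near \oo, (M p < N p)%N.
Proof.
move=> Ma Nb ab.
have H : \forall p \near \oo, 0 < (N p)%:R / p%:R - (M p)%:R / p%:R :> R.
  by apply: cvgr_gt (cvgB Nb Ma) _ _; rewrite subr_gt0.
apply: filterS2 H (near_nat_gt0 R) => p.
by rewrite subr_gt0 => + p0; rewrite ltr_pM2r ?invr_gt0// ltr_nat.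
Qed.

(** * The equation [df tau = N / p] *)

(** The product of the roots, [- c / nu], is negative, so exactly one root is positive, whatever the
    sign of [b]. *)
Lemma quadratic_pos_root (R : realType) (nu b c t : R) : 0 < nu -> 0 < c ->
  (0 < t /\ nu * t ^+ 2 + b * t = c) <->
  t = (Num.sqrt (b ^+ 2 + 4 * nu * c) - b) / (2 * nu).
Proof.
move=> nu0 c0; set d := Num.sqrt _.
have nuc : 0 < nu * c by rewrite mulr_gt0.
have d2 : d ^+ 2 = b ^+ 2 + 4 * nu * c.
  by rewrite sqr_sqrtr // addr_ge0 ?sqr_ge0 //; lra.
have bd : `|b| < d.
  rewrite -(@ltr_pXn2r _ 2) ?nnegrE ?sqrtr_ge0 // d2 real_normK ?num_real //.
  by lra.
have {bd} [bd1 bd2] : b < d /\ - d < b.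
  by move: bd; rewrite ltr_norml => /andP[].
split=> [[t0 tE]|->]; last first.
  split; first by rewrite divr_gt0 ?subr_gt0 // mulr_gt0.
  have -> : c = (d ^+ 2 - b ^+ 2) / (4 * nu) by rewrite d2; field; lra.
  by field; lra.
have db : d = 2 * nu * t + b.
  rewrite /d -tE.
  have -> : b ^+ 2 + 4 * nu * (nu * t ^+ 2 + b * t) = (2 * nu * t + b) ^+ 2 by ring.
  rewrite sqrtr_sqr ger0_norm //.
  (* The sign of [2 * nu * t + b] is read off after multiplying by [t], which gives
     [nu * t ^+ 2 + c]. *)
  have : 0 < (2 * nu * t + b) * t.
    have -> : (2 * nu * t + b) * t = nu * t ^+ 2 + c by rewrite -tE; ring.
    by rewrite addr_gt0 // mulr_gt0 // exprn_gt0.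
  by rewrite pmulr_lgt0 // => /ltW.
by rewrite db; field; lra.
Qed.

(* Clearing denominators in [df p k delta t = nu] gives
   [nu t^2 + df_slope * t = (1 - nu) delta]. *)
Definition df_slope (R : realType) (kappa nu delta : R) : R :=
  nu * (1 + delta) - kappa - (1 - kappa) * delta.

Definition df_discr (R : realType) (kappa nu delta : R) : R :=
  Num.sqrt (df_slope R kappa nu delta ^+ 2 + 4 * nu * ((1 - nu) * delta)).

Lemma df_eq_quadratic (R : realType) (p k N : nat) (delta t : R) :
  (0 < p)%N -> 0 < delta -> 0 < t ->
  df p k delta t = N%:R / p%:R <->
  N%:R / p%:R * t ^+ 2 + df_slope R (k%:R / p%:R) (N%:R / p%:R) delta * t
  = (1 - N%:R / p%:R) * delta.
Proof.
move=> p0 d0 t0; have pR : 0 < p%:R :> R by rewrite ltr0n.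
have E : (df p k delta t - N%:R / p%:R) * ((1 + t) * (delta + t)) =
    (1 - N%:R / p%:R) * delta - (N%:R / p%:R * t ^+ 2 +
    df_slope R (k%:R / p%:R) (N%:R / p%:R) delta * t).
  by rewrite /df /df_slope; field; lra.
have D0 : (1 + t) * (delta + t) != 0 by rewrite gt_eqF // mulr_gt0; lra.
split=> [H|H].
  by move: E; rewrite H subrr mul0r => /esym/eqP; rewrite subr_eq0 => /eqP.
move: E; rewrite H subrr => /eqP; rewrite mulf_eq0 (negbTE D0) orbF subr_eq0.
by move/eqP.
Qed.

(** Two conjugate forms of the same root. The first suits a negative limit of [b]; when [b] has a
    positive limit, [d - b] degenerates and the second form, with its explicit factor [delta], gives
    the order of the root. *)
Lemma df_rootE (R : realType) (p k N : nat) (delta : R) :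
  (0 < N < p)%N -> 0 < delta ->
  let kappa := k%:R / p%:R in let nu := N%:R / p%:R in
  let b := df_slope R kappa nu delta in let d := df_discr R kappa nu delta in
  [/\ 0 < df_root p k delta N, 0 < d + b,
      df_root p k delta N = (d - b) / (2 * nu) &
      df_root p k delta N = 2 * (1 - nu) * delta / (d + b) ].
Proof.
move=> /andP[N0 Np] d0 kappa nu b d.
have p0 : (0 < p)%N by exact: leq_trans Np.
have pR : 0 < p%:R :> R by rewrite ltr0n.
have nu0 : 0 < nu by rewrite divr_gt0 ?ltr0n.
have nu1 : nu < 1 by rewrite /nu ltr_pdivrMr // mul1r ltr_nat.
have c0 : 0 < (1 - nu) * delta by rewrite mulr_gt0 // subr_gt0.
have key t := quadratic_pos_root R nu b _ t nu0 c0.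
have [t0 tE] : 0 < df_root p k delta N /\
    df p k delta (df_root p k delta N) = N%:R / p%:R.
  (* The default value 0 of [xget] is excluded because the closed form is a solution. *)
  rewrite /df_root; case: xgetP => [t _ //|].
  have [+ _] := key ((d - b) / (2 * nu)).
  move=> _; have [_ /(_ erefl)[s0 sE]] := key ((d - b) / (2 * nu)).
  by move=> /(_ ((d - b) / (2 * nu))) []; split => //; apply/df_eq_quadratic.
have tE' := (df_eq_quadratic R p k N delta _ p0 d0 t0).1 tE.
have tc := (key _).1 (conj t0 tE').
rewrite -/(df_discr R kappa nu delta) -/d in tc.
have db : d + b = 2 * (nu * df_root p k delta N + b).
  have -> : d = 2 * nu * df_root p k delta N + b by rewrite tc; field; lra.
  by ring.
have tdb : (nu * df_root p k delta N + b) * df_root p k delta N = (1 - nu) * delta.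
  by rewrite -tE' -/kappa -/nu -/b; ring.
have db0 : 0 < nu * df_root p k delta N + b.
  by rewrite -(pmulr_lgt0 _ t0) tdb.
split=> //; first by rewrite db mulr_gt0.
by rewrite db -(mulrA 2 (1 - nu)) -tdb; field; lra.
Qed.

(** * Asymptotics of the positive root *)

Section Spectrum.
Context {R : realType} (k : nat -> nat) (delta : nat -> R) (vartheta eta : R).

(** The data common to teacher and student. The bottleneck size [N] stays separate, so that the same
    asymptotics serve [NT], [NS] and [m]. *)
Definition spectrum : Prop :=
  [/\ 0 < vartheta < 1, 0 < eta & forall p, 0 < delta p] /\
  [/\ tends (fun p => (k p)%:R / p%:R) vartheta &
      tends (fun p => (p%:R - (k p)%:R) * delta p) eta].

Context (hs : spectrum).

Let hv0 : 0 < vartheta. Proof. by case: hs => -[/andP[]]. Qed.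
Let hv1 : vartheta < 1. Proof. by case: hs => -[/andP[]]. Qed.
Let he : 0 < eta. Proof. by case: hs => -[]. Qed.
Let hd p : 0 < delta p. Proof. by case: hs => -[]. Qed.
Let hk : tends (fun p => (k p)%:R / p%:R) vartheta.
Proof. by case: hs => _ []. Qed.
Let hD : tends (fun p => (p%:R - (k p)%:R) * delta p) eta.
Proof. by case: hs => _ []. Qed.

Lemma near_rank_lt : \forall p \near \oo, (k p < p)%N.
Proof. exact: near_ltn_ratio hk (tends_nat_ratio1 R) hv1. Qed.

(** Division by [1 - k / p]: thus [delta] is of exact order [1 / p]. *)
Lemma tends_scaled_delta : tends (fun p => p%:R * delta p) (eta / (1 - vartheta)).
Proof.
apply: (@tends_near_eq _ (fun p => (p%:R - (k p)%:R) * delta p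
                                 * (1 - (k p)%:R / p%:R)^-1)); [| by []|].
  lim. by apply: lt0r_neq0; rewrite subr_gt0.
apply: filterS2 near_rank_lt (near_nat_gt0 R) => p kp p0.
have : (k p)%:R < p%:R :> R by rewrite ltr_nat.
by move=> kp'; field; lra.
Qed.

Lemma tends_delta0 : tends delta 0.
Proof.
have h := tends_scaled_delta; have h' := tends_natV R.
apply: (@tends_near_eq _ (fun p => p%:R * delta p * p%:R^-1));
  [by lim | by rewrite mulr0 |].
by apply: filterS (near_nat_gt0 R) => p p0; field; lra.
Qed.

Context (N : nat -> nat) (rho : R).
Context (hN0 : forall p, (0 < N p)%N) (hrho : 0 < rho < 1).
Context (hN : tends (fun p => (N p)%:R / p%:R) rho).

Let tau p := df_root p (k p) (delta p) (N p).

Lemma near_size_lt : \forall p \near \oo, (0 < N p < p)%N.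
Proof.
apply: filterS (near_ltn_ratio R N id rho 1 hN (tends_nat_ratio1 R) _) => [p ->|].
  by rewrite hN0.
by case/andP: hrho.
Qed.

Let slope p := df_slope R ((k p)%:R / p%:R) ((N p)%:R / p%:R) (delta p).
Let discr p := df_discr R ((k p)%:R / p%:R) ((N p)%:R / p%:R) (delta p).

(** The sign of this limit decides the scale of the root: [discr - slope] tends to
    [2 * (vartheta - rho)] if [rho < vartheta], and [discr + slope] to [2 * (rho - vartheta)] if
    [vartheta < rho]. *)
Let tends_slope : tends slope (rho - vartheta).
Proof.
have h := tends_delta0.
by rewrite /slope /df_slope; apply: tends_eq; [lim | ring].
Qed.

Let tends_discr : tends discr `|rho - vartheta|.
Proof.
have h := tends_delta0; have hsl := tends_slope.
rewrite -sqrtr_sqr.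
have H : tends (fun p => slope p ^+ 2 +
    4 * ((N p)%:R / p%:R) * ((1 - (N p)%:R / p%:R) * delta p))
  ((rho - vartheta) ^+ 2).
  by apply: tends_eq; [lim | ring].
exact: (cvg_comp _ _ H (@sqrt_continuous R _)).
Qed.

Lemma near_df_root_gt0 : \forall p \near \oo, 0 < tau p.
Proof.
apply: filterS near_size_lt => p Np.
by case: (df_rootE R p (k p) (N p) (delta p) Np (hd p)).
Qed.

Lemma tends_df_root_lt : rho < vartheta ->
  tends tau (vartheta / rho - 1).
Proof.
move=> rv; have hsl := tends_slope; have hdi := tends_discr.
case/andP: hrho => r0 r1.
rewrite ltr0_norm ?subr_lt0 // in hdi.
apply: (@tends_near_eq _ (fun p => (discr p - slope p) *
  (2 * ((N p)%:R / p%:R))^-1));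
  [by lim; apply: lt0r_neq0; rewrite mulr_gt0 | by field; lra |].
apply: filterS near_size_lt => p Np.
by case: (df_rootE R p (k p) (N p) (delta p) Np (hd p)).
Qed.

Lemma tends_df_root_gt : vartheta < rho ->
  tends (fun p => tau p / delta p) ((1 - rho) / (rho - vartheta)).
Proof.
move=> rv; have hsl := tends_slope; have hdi := tends_discr.
case/andP: hrho => r0 r1.
rewrite gtr0_norm ?subr_gt0 // in hdi.
apply: (@tends_near_eq _ (fun p => 2 * (1 - (N p)%:R / p%:R) *
  (discr p + slope p)^-1)); [by lim; apply: lt0r_neq0; lra | by field; lra |].
apply: filterS near_size_lt => p Np.
case: (df_rootE R p (k p) (N p) (delta p) Np (hd p)) => _ _ _.
by rewrite /tau => ->; rewrite [RHS]mulrAC mulfK // gt_eqF // hd.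
Qed.

End Spectrum.

(** * Teacher and student limits *)

Section Teacher.
Context {R : realType} (k : nat -> nat) (delta : nat -> R) (vartheta eta : R).
Context (hs : spectrum k delta vartheta eta).
Context (NT : nat -> nat) (rhoT : R).
Context (hN0 : forall p, (0 < NT p)%N) (hrhoT : 0 < rhoT < 1).
Context (hNT : tends (fun p => (NT p)%:R / p%:R) rhoT).
Context (hne : rhoT != vartheta).

Let tau p := df_root p (k p) (delta p) (NT p).
Let V p := coefV p (k p) (delta p) (NT p).
Let S p := coefS p (k p) (delta p) (NT p).

Let near_tauT : \forall p \near \oo,
  [/\ 0 < p%:R :> R, 0 < tau p, 0 < delta p, (k p)%:R < p%:R :> R &
      tauT p (k p) (delta p) (NT p) = tau p].
Proof.
have [[_ _ hd] _] := hs.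
apply: filterS3 (near_size_lt NT rhoT hN0 hrhoT hNT) (near_rank_lt k delta _ _ hs)
  (near_df_root_gt0 k delta _ _ hs NT rhoT hN0 hrhoT hNT) => p /andP[N0 Np] kp t0.
by rewrite ltr_nat ltr0n (leq_ltn_trans _ Np) // /tauT Np; split.
Qed.

Lemma teacher_limits : exists v s : R,
  [/\ 0 < v, 0 < s, v * LambdaT vartheta rhoT = s * eta,
      tends (fun p => p%:R * V p) v & tends S s].
Proof.
have [[/andP[v0 v1] e0 hd] [hk hD]] := hs.
have hd0 := tends_delta0 k delta _ _ hs.
have hpd := tends_scaled_delta k delta _ _ hs.
have hV0 := tends_natV R.
case/andP: hrhoT => r0 r1.
(* Since [S = a - V] and [V = (p * V) / p] tends to 0, [S] has the limit of [a = 1 / (1 + tau)]. *)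
suff [v [s [hv hvs hs0 pV aS]]] : exists v s : R,
  [/\ 0 < v, v * LambdaT vartheta rhoT = s * eta, 0 < s,
      tends (fun p => p%:R * V p) v & tends (fun p => (1 + tau p)^-1) s].
  exists v, s; split => //.
  apply: (@tends_near_eq _ (fun p => (1 + tau p)^-1 - p%:R^-1 * (p%:R * V p))).
  - by lim.
  - by rewrite mul0r subr0.
  apply: filterS near_tauT => p [p0 _ _ _ tE].
  rewrite mulKf ?gt_eqF // /S /coefS /V /coefV.
  by rewrite {1}/coefa tE.
have [rv|rv] := ltP rhoT vartheta.
- have ht : tends tau _ := tends_df_root_lt k delta _ _ hs NT rhoT hN0 hrhoT hNT rv.
  set t0 := vartheta / rhoT - 1 in ht.
  have t0E : t0 = (vartheta - rhoT) / rhoT by rewrite /t0; field; lra.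
  have t0_gt0 : 0 < t0 by rewrite t0E divr_gt0 // subr_gt0.
  have h1 : tends (fun p => (1 + tau p)^-1) (1 + t0)^-1.
    by lim; apply: lt0r_neq0; lra.
  (* The limit of [c] times that of [p * Theta]; the zeros are the limits of [1 / p] and [delta].
     The values simplify to [v = eta / (vartheta * t0)] and [s = rhoT / vartheta]. *)
  exists (((1 + t0)^-1 - (1 + t0)^-1 ^+ 2) *
     (0 + vartheta * ((0 + t0) ^+ 2 / (eta * (1 + t0) ^+ 2)))^-1), (1 + t0)^-1.
  have P1 : 0 < eta * (1 + t0) ^+ 2 by rewrite mulr_gt0 // exprn_gt0 //; lra.
  have P2 : 0 < 0 + vartheta * ((0 + t0) ^+ 2 / (eta * (1 + t0) ^+ 2)).
    by rewrite !add0r mulr_gt0 // divr_gt0 // exprn_gt0.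
  have P3 : (1 + t0)^-1 - (1 + t0)^-1 ^+ 2 = t0 / (1 + t0) ^+ 2 by field; lra.
  split.
  + rewrite P3; apply: mulr_gt0; last by rewrite invr_gt0.
    by rewrite divr_gt0 // exprn_gt0 //; lra.
  + by rewrite /LambdaT rv P3 t0E; field; lra.
  + by rewrite invr_gt0; lra.
  + apply: (@tends_near_eq _ (fun p => ((1 + tau p)^-1 - (1 + tau p)^-1 ^+ 2) *
      (p%:R^-1 + ((k p)%:R / p%:R) * ((delta p + tau p) ^+ 2 /
       ((p%:R - (k p)%:R) * delta p * (1 + tau p) ^+ 2)))^-1)); [|by []|].
    * by lim; apply: lt0r_neq0.
    apply: filterS near_tauT => p [p0 _ _ _ tE].
    rewrite /V /coefV /coefc /coefa /coefTheta tE /= [RHS]mulrCA; congr (_ * _).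
    rewrite -[(k p)%:R * _ / _ in RHS]mulrA; set X := (_ ^+ 2 / _).
    have -> : p%:R^-1 + (k p)%:R / p%:R * X = (1 + (k p)%:R * X) / p%:R.
      by field; lra.
    by rewrite invf_div.
  + exact: h1.
- have {}rv : vartheta < rhoT by rewrite lt_neqAle eq_sym hne.
  have hx : tends (fun p => tau p / delta p) _ :=
    tends_df_root_gt k delta _ _ hs NT rhoT hN0 hrhoT hNT rv.
  set x0 := _ / _ in hx.
  have ht : tends tau 0.
    apply: (@tends_near_eq _ (fun p => tau p / delta p * delta p)).
    - by lim.
    - by rewrite mulr0.
    by apply: nearW => p; rewrite divfK // gt_eqF.
  have hpt : tends (fun p => p%:R * tau p) (x0 * (eta / (1 - vartheta))).
    apply: (@tends_near_eq _ (fun p => tau p / delta p * (p%:R * delta p)));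
      [by lim | by [] |].
    by apply: nearW => p; rewrite mulrCA divfK // gt_eqF.
  have h1 : tends (fun p => (1 + tau p)^-1) (1 + 0)^-1.
    by lim; apply: lt0r_neq0; lra.
  (* Now [tau] is of order [1 / p], so [c] is equivalent to [tau] and [Theta] tends to 1: [v] is the
     limit of [p * tau], equal to [eta / Lambda_T]. *)
  exists (x0 * (eta / (1 - vartheta))), 1.
  split.
  + by rewrite mulr_gt0 // divr_gt0 //; lra.
  + by rewrite /LambdaT ltNge (ltW rv) /= /x0; field; lra.
  + by [].
  + apply: (@tends_near_eq _ (fun p => p%:R * tau p * (1 + tau p)^-1 ^+ 2 *
      (1 + ((k p)%:R / p%:R) * (p%:R * delta p + p%:R * tau p) *
       ((delta p + tau p) / ((p%:R - (k p)%:R) * delta p * (1 + tau p) ^+ 2)))^-1)).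
    * by lim; apply: lt0r_neq0; rewrite ?addr0 ?mul0r ?mulr0 ?addr0 ?expr1n ?mulr1.
    * by rewrite ?addr0 ?mul0r ?mulr0 ?addr0 ?expr1n; field; lra.
    apply: filterS near_tauT => p [p0 t0 d0 kp tE].
    rewrite /V /coefV /coefc /coefa /coefTheta tE /= [RHS]mulrA; congr (_ * _^-1).
      by field; lra.
    by congr (1 + _); field; rewrite !gt_eqF //; lra.
  + by move: h1; rewrite addr0 invr1.
Qed.

End Teacher.

Section Student.
Context {R : realType} (k : nat -> nat) (delta : nat -> R) (vartheta eta : R).
Context (hs : spectrum k delta vartheta eta).
Context (V S : nat -> R) (v s : R).
Context (hV : tends (fun p => p%:R * V p) v) (hS : tends S s).
Context (N : nat -> nat) (rho : R).
Context (hN0 : forall p, (0 < N p)%N) (hrho : 0 < rho < 1).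
Context (hN : tends (fun p => (N p)%:R / p%:R) rho).

Let tau p := df_root p (k p) (delta p) (N p).

Let near_tau : \forall p \near \oo,
  [/\ 0 < p%:R :> R, 0 < tau p & 0 < delta p].
Proof.
have [[_ _ hd] _] := hs.
by apply: filterS2 (near_nat_gt0 R)
  (near_df_root_gt0 k delta _ _ hs N rho hN0 hrho hN) => p.
Qed.

Let hV0 : tends V 0.
Proof.
have h := tends_natV R.
apply: (@tends_near_eq _ (fun p => p%:R^-1 * (p%:R * V p))).
- by lim.
- by rewrite mul0r.
by apply: filterS (near_nat_gt0 R) => p p0; rewrite mulKf ?gt_eqF.
Qed.

(** Here [tau] stays away from 0 while [delta] and [V] vanish, so only the [S] terms survive; in
    [df2] only [vartheta / (1 + t) ^+ 2] does, and [1 + t = vartheta / rho]. *)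
Lemma student_limits_lt : rho < vartheta ->
  let t := vartheta / rho - 1 in
  [/\ 0 < t,
      tends (fun p => tau p * V p * Delta (delta p) (tau p)) 0,
      tends (fun p => tau p * (S p / (1 + tau p) + V p / (delta p + tau p)))
        (t * s / (1 + t)),
      tends (fun p => tau p ^+ 2 * (S p / (1 + tau p) ^+ 2
                                    + V p / (delta p + tau p) ^+ 2))
        (t ^+ 2 * s / (1 + t) ^+ 2) &
      tends (fun p => df2 p (k p) (delta p) (tau p)) (rho ^+ 2 / vartheta)].
Proof.
move=> rv t.
have [[/andP[v0 v1] e0 hd] [hk hD]] := hs.
have hd0 := tends_delta0 k delta _ _ hs.
have ht : tends tau _ := tends_df_root_lt k delta _ _ hs N rho hN0 hrho hN rv.
case/andP: hrho => r0 r1.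
have tE : t = (vartheta - rho) / rho by rewrite /t; field; lra.
have t_gt0 : 0 < t by rewrite tE divr_gt0 // subr_gt0.
rewrite -/t in ht.
have n1 : 1 + t != 0 by apply: lt0r_neq0; lra.
have n2 : 0 + t != 0 by apply: lt0r_neq0; lra.
split=> //.
- by apply: tends_eq; [rewrite /Delta; lim | rewrite mulr0 mul0r].
- by apply: tends_eq; [lim | rewrite mul0r addr0 mulrA].
- by apply: tends_eq; [lim; rewrite expf_neq0 | rewrite mul0r addr0 mulrA].
- apply: (@tends_near_eq _ (fun p => (k p)%:R / p%:R / (1 + tau p) ^+ 2
     + (1 - (k p)%:R / p%:R) * delta p ^+ 2 / (delta p + tau p) ^+ 2)).
  + by lim; rewrite expf_neq0.
  + by rewrite expr0n /= mulr0 mul0r addr0 tE; field; lra.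
  apply: filterS near_tau => p [p0 t0 d0].
  by rewrite /df2; field; lra.
Qed.

(** Here [tau], [delta] and [V] are all of order [1 / p], hence the factor [p]. The constants [q]
    and [w] are the limits of [tau / (delta + tau)] and [p * tau]; the [S] part of the second-order
    term carries an extra [tau] and disappears. *)
Lemma student_limits_gt : vartheta < rho ->
  let q := (1 - rho) / (1 - vartheta) in
  let w := q * eta / (rho - vartheta) in
  [/\ tends (fun p => p%:R * (tau p * V p * Delta (delta p) (tau p))) (v * q),
      tends (fun p => p%:R *
          (tau p * (S p / (1 + tau p) + V p / (delta p + tau p))))
        (w * s + v * q),
      tends (fun p => p%:R *
          (tau p ^+ 2 * (S p / (1 + tau p) ^+ 2
                         + V p / (delta p + tau p) ^+ 2)))
        (v * q ^+ 2) &
      tends (fun p => df2 p (k p) (delta p) (tau p))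
        (vartheta + (rho - vartheta) ^+ 2 / (1 - vartheta))].
Proof.
move=> rv q w.
have [[/andP[v0 v1] e0 hd] [hk hD]] := hs.
have hd0 := tends_delta0 k delta _ _ hs.
have hpd := tends_scaled_delta k delta _ _ hs.
have hx : tends (fun p => tau p / delta p) _ :=
  tends_df_root_gt k delta _ _ hs N rho hN0 hrho hN rv.
case/andP: hrho => r0 r1.
have n0 : 1 + 0 != 0 :> R by apply: lt0r_neq0; lra.
have ht : tends tau 0.
  apply: (@tends_near_eq _ (fun p => tau p / delta p * delta p)).
  - by lim.
  - by rewrite mulr0.
  by apply: nearW => p; rewrite divfK // gt_eqF.
have hpt : tends (fun p => p%:R * tau p) w.
  apply: (@tends_near_eq _ (fun p => tau p / delta p * (p%:R * delta p))).
  - by lim.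
  - by rewrite /w /q; field; lra.
  by apply: nearW => p; rewrite mulrCA divfK // gt_eqF.
have hq : tends (fun p => tau p / (delta p + tau p)) q.
  apply: (@tends_near_eq _ (fun p => tau p / delta p / (1 + tau p / delta p))).
  - have r : 0 < (1 - rho) / (rho - vartheta) by rewrite divr_gt0 //; lra.
    by lim; apply: lt0r_neq0; lra.
  - by rewrite /q; field; lra.
  by apply: filterS near_tau => p [p0 t0 d0]; field; lra.
split.
- apply: (@tends_near_eq _ (fun p => p%:R * V p *
    (tau p / (delta p + tau p) - tau p / (1 + tau p)))).
  + by lim.
  + by rewrite mul0r subr0.
  by apply: filterS near_tau => p [p0 t0 d0]; rewrite /Delta; field; lra.
- apply: (@tends_near_eq _ (fun p => p%:R * tau p * (S p / (1 + tau p)) +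
    p%:R * V p * (tau p / (delta p + tau p)))).
  + by lim.
  + by field.
  by apply: filterS near_tau => p [p0 t0 d0]; field; lra.
- apply: (@tends_near_eq _ (fun p => p%:R * tau p * (tau p * S p / (1 + tau p) ^+ 2)
    + p%:R * V p * (tau p / (delta p + tau p)) ^+ 2)).
  + by lim; rewrite expf_neq0.
  + by rewrite mul0r mul0r mulr0 add0r.
  by apply: filterS near_tau => p [p0 t0 d0]; field; lra.
- apply: (@tends_near_eq _ (fun p => (k p)%:R / p%:R / (1 + tau p) ^+ 2
     + (1 - (k p)%:R / p%:R) * (1 - tau p / (delta p + tau p)) ^+ 2)).
  + by lim; rewrite expf_neq0.
  + by rewrite addr0 expr1n divr1 /q; field; lra.
  by apply: filterS near_tau => p [p0 t0 d0]; rewrite /df2; field; lra.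
Qed.

End Student.

(** * The gain *)

Lemma tends_gt0 (R : realType) (u : nat -> R) (a : R) :
  tends u a -> 0 < a -> \forall p \near \oo, 0 < u p.
Proof. by move=> ua a0; apply: cvgr_gt ua _ a0. Qed.

Lemma tends_lt0 (R : realType) (u : nat -> R) (a : R) :
  tends u a -> a < 0 -> \forall p \near \oo, u p < 0.
Proof. by move=> ua a0; apply: cvgr_lt ua _ a0. Qed.

Section Gain.
Context {R : realType} (vartheta eta rhoT rhom rhoS : R).
Context (hvartheta : 0 < vartheta < 1) (hrhoT : 0 < rhoT < 1) (heta : 0 < eta).
Context (hrhom : 0 < rhom) (hrhoS : 0 < rhoS) (hTtheta : rhoT != vartheta).
Context (s : model_seq R) (hs : admissible vartheta eta rhoT rhom rhoS s).

Let k := seq_k s.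
Let NT := seq_NT s.
Let m := seq_m s.
Let NS := seq_NS s.
Let delta := seq_delta s.
Let Lambda := LambdaT vartheta rhoT.
Let V p := coefV p (k p) (delta p) (NT p).
Let S p := coefS p (k p) (delta p) (NT p).

Let hspec : spectrum k delta vartheta eta.
Proof.
case: hs => _ [hd [hk hD _ _ _]]; split; split => // p.
by case/andP: (hd p).
Qed.

Let hm : tends (fun p => (m p)%:R / p%:R) rhom.
Proof. by case: hs => _ [_ []]. Qed.

Let hNS : tends (fun p => (NS p)%:R / p%:R) rhoS.
Proof. by case: hs => _ [_ []]. Qed.

Let hm0 p : (0 < m p)%N. Proof. by case: hs => /(_ p)[]. Qed.
Let hNS0 p : (0 < NS p)%N. Proof. by case: hs => /(_ p)[]. Qed.

Let teacher : exists v a : R, [/\ 0 < v, 0 < a, v * Lambda = a * eta,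
  tends (fun p => p%:R * V p) v & tends S a].
Proof.
case: hs => h0 [_ [_ _ hT _ _]]; have hT0 p : (0 < NT p)%N by case: (h0 p).
exact: (teacher_limits k delta _ _ hspec NT rhoT hT0 hrhoT hT hTtheta).
Qed.

Let tauF p := df_root p (k p) (delta p) (NS p).
Let tauM p := df_root p (k p) (delta p) (m p).

(** Selects the branch for large [p] and expresses the gain through ratios to [p], whose limits are
    known; [near_gain_sample] does the same for the other bottleneck. *)
Lemma near_gain_feature : rhoS < 1 -> rhoS < rhom ->
  \forall p \near \oo, gain s p =
    2 * (tauF p * V p * Delta (delta p) (tauF p))
    - tauF p * (S p / (1 + tauF p) + V p / (delta p + tauF p))
      * (1 - (NS p)%:R / p%:R / ((m p)%:R / p%:R))^-1.
Proof.
move=> S1 Sm.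
apply: filterS3 (near_nat_gt0 R) (near_ltn_ratio R NS m _ _ hNS hm Sm)
  (near_ltn_ratio R NS id _ _ hNS (tends_nat_ratio1 R) S1) => p p0 h1 h2.
have F : (p < minn (m p) (NS p))%N = false.
  by apply/negbTE; rewrite -leqNgt geq_min (ltnW h2) orbT.
have T : (NS p < minn (m p) p)%N by rewrite leq_min h1 h2.
rewrite /gain /W2SG /penalty /tauS -/(k p) -/(delta p) -/(m p) -/(NS p) -/(NT p).
rewrite F T -/(tauF p) /T1 -/(V p) -/(S p) /=.
have -> : (NS p)%:R / p%:R / ((m p)%:R / p%:R) = (NS p)%:R / (m p)%:R :> R.
  have m0 : 0 < (m p)%:R :> R by rewrite ltr0n.
  by field; lra.
by rewrite !mulrA.
Qed.

Lemma near_gain_sample : rhom < 1 -> rhom < rhoS ->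
  \forall p \near \oo, gain s p =
    2 * (tauM p * V p * Delta (delta p) (tauM p))
    - (tauM p ^+ 2 * (S p / (1 + tauM p) ^+ 2 + V p / (delta p + tauM p) ^+ 2)
       * (1 - df2 p (k p) (delta p) (tauM p) / ((m p)%:R / p%:R))^-1
      + tauM p * (S p / (1 + tauM p) + V p / (delta p + tauM p))
        * ((m p)%:R / p%:R / ((NS p)%:R / p%:R)
           * (1 - (m p)%:R / p%:R / ((NS p)%:R / p%:R))^-1)).
Proof.
move=> m1 mS.
apply: filterS3 (near_nat_gt0 R) (near_ltn_ratio R m NS _ _ hm hNS mS)
  (near_ltn_ratio R m id _ _ hm (tends_nat_ratio1 R) m1) => p p0 h1 h2.
have F : (p < minn (m p) (NS p))%N = false.
  by apply/negbTE; rewrite -leqNgt geq_min (ltnW h2).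
have F' : (NS p < minn (m p) p)%N = false.
  by apply/negbTE; rewrite -leqNgt geq_min (ltnW h1).
have T : (m p < minn p (NS p))%N by rewrite leq_min h1 h2.
rewrite /gain /W2SG /penalty /tauS -/(k p) -/(delta p) -/(m p) -/(NS p) -/(NT p).
rewrite F F' T -/(tauM p) /T1 /T2 -/(V p) -/(S p) /=.
have m0 : 0 < (m p)%:R :> R by rewrite ltr0n.
have N0 : 0 < (NS p)%:R :> R by rewrite ltr0n.
have -> : (m p)%:R / p%:R / ((NS p)%:R / p%:R) = (m p)%:R / (NS p)%:R :> R.
  by field; lra.
have -> : df2 p (k p) (delta p) (tauM p) / ((m p)%:R / p%:R) =
    p%:R / (m p)%:R * df2 p (k p) (delta p) (tauM p).
  by field; lra.
by rewrite !mulrA.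
Qed.

Lemma gain_feature_below : rhoS < vartheta -> rhoS < rhom -> eventually_neg s.
Proof.
move=> Sv Sm; have [v0 v1] := andP hvartheta.
have [v [a [v_gt0 a_gt0 _ hV hS]]] := teacher.
have S1 : rhoS < 1 by lra.
have S01 : 0 < rhoS < 1 by apply/andP.
have [t0 L1 L2 _ _] :=
  student_limits_lt k delta _ _ hspec V S v a hV hS NS rhoS hNS0 S01 hNS Sv.
set t := vartheta / rhoS - 1 in t0 L1 L2.
have d0 : 0 < 1 - rhoS / rhom by rewrite subr_gt0 ltr_pdivrMr // mul1r.
have L : tends (gain s) (- (t * a / (1 + t) * (1 - rhoS / rhom)^-1)).
  apply: (tends_near_eqr _ _ _ _ _ (near_gain_feature S1 Sm)).
    by rewrite /tauF; lim; rewrite gt_eqF.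
  by rewrite mulr0 add0r.
apply: tends_lt0 L _; rewrite oppr_lt0 mulr_gt0 ?invr_gt0 // divr_gt0 ?mulr_gt0 //.
by lra.
Qed.

Lemma gain_sample_below : rhom < vartheta -> rhom < rhoS -> eventually_neg s.
Proof.
move=> mv mS; have [v0 v1] := andP hvartheta.
have [v [a [v_gt0 a_gt0 _ hV hS]]] := teacher.
have m1 : rhom < 1 by lra.
have m01 : 0 < rhom < 1 by apply/andP.
have [t0 L1 L2 L3 L4] :=
  student_limits_lt k delta _ _ hspec V S v a hV hS m rhom hm0 m01 hm mv.
set t := vartheta / rhom - 1 in t0 L1 L2 L3.
have d0 : 0 < 1 - rhom / rhoS by rewrite subr_gt0 ltr_pdivrMr // mul1r.
(* The limit of the denominator [1 - (p / m) * df2]. *)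
have d1 : 0 < 1 - rhom ^+ 2 / vartheta / rhom.
  have -> : 1 - rhom ^+ 2 / vartheta / rhom = (vartheta - rhom) / vartheta.
    by field; lra.
  by rewrite divr_gt0 // subr_gt0.
have L : tends (gain s) (- (t ^+ 2 * a / (1 + t) ^+ 2
    * (1 - rhom ^+ 2 / vartheta / rhom)^-1
    + t * a / (1 + t) * (rhom / rhoS * (1 - rhom / rhoS)^-1))).
  apply: (tends_near_eqr _ _ _ _ _ (near_gain_sample m1 mS)).
    by rewrite /tauM; lim; rewrite gt_eqF.
  by rewrite mulr0 add0r.
have t1 : 0 < 1 + t by lra.
apply: tends_lt0 L _; rewrite oppr_lt0 addr_gt0 //.
  by rewrite mulr_gt0 ?invr_gt0 // divr_gt0 ?mulr_gt0 // exprn_gt0.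
by rewrite !(mulr_gt0, divr_gt0, invr_gt0).
Qed.

Lemma gain_feature_limit : vartheta < rhoS < 1 -> rhoS < rhom ->
  exists2 c, 0 < c & tends (fun p => p%:R * gain s p)
    (c * ((rhoS - vartheta - Lambda) * rhom - 2 * rhoS * (rhoS - vartheta))).
Proof.
move=> /andP[vS S1] Sm; have [v0 v1] := andP hvartheta.
have [v [a [v_gt0 a_gt0 vLa hV hS]]] := teacher.
have S01 : 0 < rhoS < 1 by apply/andP.
have [L1 L2 _ _] :=
  student_limits_gt k delta _ _ hspec V S v a hV hS NS rhoS hNS0 S01 hNS vS.
set q := (1 - rhoS) / (1 - vartheta) in L1 L2.
have q0 : 0 < q by rewrite divr_gt0; lra.
have d0 : 0 < 1 - rhoS / rhom by rewrite subr_gt0 ltr_pdivrMr // mul1r.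
exists (v * q / ((rhoS - vartheta) * (rhom - rhoS))).
  by rewrite !(divr_gt0, mulr_gt0, subr_gt0).
apply: (@tends_near_eq _ (fun p =>
    2 * (p%:R * (tauF p * V p * Delta (delta p) (tauF p)))
    - p%:R * (tauF p * (S p / (1 + tauF p) + V p / (delta p + tauF p)))
      * (1 - (NS p)%:R / p%:R / ((m p)%:R / p%:R))^-1)).
- by rewrite /tauF; lim; rewrite gt_eqF.
(* The relation [v * Lambda = a * eta] eliminates [a] and [eta], so that [v * q] factors out of the
   whole limit. *)
- have -> : q * eta / (rhoS - vartheta) * a + v * q =
      v * q * (Lambda + rhoS - vartheta) / (rhoS - vartheta).
    rewrite (_ : v * q * (Lambda + rhoS - vartheta) =
      q * (v * Lambda) + v * q * (rhoS - vartheta)); last by ring.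
    by rewrite vLa; field; lra.
  by field; lra.
by apply: filterS (near_gain_feature S1 Sm) => p ->; ring.
Qed.

Lemma gain_sample_limit : vartheta < rhom < 1 -> rhom < rhoS ->
  exists2 c, 0 < c & tends (fun p => p%:R * gain s p)
    (c * (linDE vartheta rhoT rhoS * rhom - 2 * rhom ^+ 2
          - 2 * vartheta * rhoS)).
Proof.
move=> /andP[vm m1] mS; have [v0 v1] := andP hvartheta.
have [v [a [v_gt0 a_gt0 vLa hV hS]]] := teacher.
have m01 : 0 < rhom < 1 by apply/andP.
have [L1 L2 L3 L4] :=
  student_limits_gt k delta _ _ hspec V S v a hV hS m rhom hm0 m01 hm vm.
set q := (1 - rhom) / (1 - vartheta) in L1 L2 L3.
have q0 : 0 < q by rewrite divr_gt0; lra.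
have d0 : 0 < 1 - rhom / rhoS by rewrite subr_gt0 ltr_pdivrMr // mul1r.
(* The factor [q] of this denominator cancels one from [v * q ^+ 2], so all terms of the limit share
   [v * q]. *)
have d1E : 1 - (vartheta + (rhom - vartheta) ^+ 2 / (1 - vartheta)) / rhom =
    (rhom - vartheta) * q / rhom by rewrite /q; field; lra.
have d1 : 0 < (rhom - vartheta) * q / rhom.
  by rewrite divr_gt0 // mulr_gt0 //; lra.
exists (v * q / ((rhom - vartheta) * (rhoS - rhom))).
  by rewrite !(divr_gt0, mulr_gt0, subr_gt0).
apply: (@tends_near_eq _ (fun p =>
    2 * (p%:R * (tauM p * V p * Delta (delta p) (tauM p)))
    - (p%:R * (tauM p ^+ 2 * (S p / (1 + tauM p) ^+ 2
                              + V p / (delta p + tauM p) ^+ 2))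
       * (1 - df2 p (k p) (delta p) (tauM p) / ((m p)%:R / p%:R))^-1
      + p%:R * (tauM p * (S p / (1 + tauM p) + V p / (delta p + tauM p)))
        * ((m p)%:R / p%:R / ((NS p)%:R / p%:R)
           * (1 - (m p)%:R / p%:R / ((NS p)%:R / p%:R))^-1)))).
- by rewrite /tauM; lim; rewrite ?d1E gt_eqF.
- have -> : q * eta / (rhom - vartheta) * a + v * q =
      v * q * (Lambda + rhom - vartheta) / (rhom - vartheta).
    rewrite (_ : v * q * (Lambda + rhom - vartheta) =
      q * (v * Lambda) + v * q * (rhom - vartheta)); last by ring.
    by rewrite vLa; field; lra.
  by rewrite d1E /linDE -/Lambda; field; lra.
by apply: filterS (near_gain_sample m1 mS) => p ->; ring.
Qed.

End Gain.

Lemma scaled_limit_pos (R : realType) (s : model_seq R) (a : R) :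
  tends (fun p => p%:R * gain s p) a -> 0 < a -> eventually_pos s.
Proof.
move=> sa a0; apply: filterS2 (tends_gt0 _ _ _ sa a0) (near_nat_gt0 R) => p.
by move=> + p0; rewrite pmulr_rgt0.
Qed.

Lemma scaled_limit_neg (R : realType) (s : model_seq R) (a : R) :
  tends (fun p => p%:R * gain s p) a -> a < 0 -> eventually_neg s.
Proof.
move=> sa a0; apply: filterS2 (tends_lt0 _ _ _ sa a0) (near_nat_gt0 R) => p.
by move=> + p0; rewrite pmulr_rlt0.
Qed.

Lemma eventually_neg_not_pos (R : realType) (s : model_seq R) :
  eventually_neg s -> ~ eventually_pos s.
Proof.
move=> sn sp; have [p []] := filter_ex (filterI sn sp).
by move=> /lt_trans h /h; rewrite ltxx.
Qed.

(** * Admissible sequences with prescribed limits *)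

(** The successor keeps sizes positive, and for [0 <= x p] the ratio to [p] lies between [x p] and
    [x p + 1 / p]. The target [x] may vary with [p], as the diagonal argument requires. *)
Definition ratio_seq (R : realType) (x : nat -> R) (p : nat) : nat :=
  (Num.truncn (x p * p%:R)).+1.

Lemma tends_ratio_seq (R : realType) (x : nat -> R) (a : R) :
  (forall p, 0 <= x p) -> tends x a ->
  tends (fun p => (ratio_seq R x p)%:R / p%:R) a.
Proof.
move=> x0 xa; have h := tends_natV R.
have xa' : tends (fun p => x p + p%:R^-1) a.
  by apply: tends_eq; [lim | rewrite addr0].
apply: squeeze_cvgr xa xa'; apply: filterS (near_nat_gt0 R) => p p0.
have /truncn_itv/andP[h1 h2] : 0 <= x p * p%:R by rewrite mulr_ge0.
rewrite ler_pdivlMr // ler_pdivrMr // mulrDl mulVf ?gt_eqF //.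
by rewrite (ltW h2) /ratio_seq -natr1 lerD2r.
Qed.

Section Approximation.
Context {R : realType} (vartheta eta rhoT rhoS : R).
Context (hvartheta : 0 < vartheta < 1) (heta : 0 < eta).
Context (hrhoT : 0 < rhoT) (hrhoS : 0 < rhoS).

(** The shift [c + 1] keeps [delta] below 1 at every [p], 0 included, without changing the limit [c]
    of [p * delta]. *)
Definition model_of (x : nat -> R) : model_seq R :=
  let c := eta / (1 - vartheta) in
  ModelSeq (ratio_seq R (fun=> vartheta)) (ratio_seq R (fun=> rhoT))
    (ratio_seq R x) (ratio_seq R (fun=> rhoS)) (fun p => c / (p%:R + (c + 1))).

Lemma admissible_model_of (x : nat -> R) (rhom : R) :
  (forall p, 0 <= x p) -> tends x rhom ->
  admissible vartheta eta rhoT rhom rhoS (model_of x).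
Proof.
move=> x0 xa; have [v0 v1] := andP hvartheta.
have cst (a : R) : 0 < a -> tends (fun p => (ratio_seq R (fun=> a) p)%:R / p%:R) a.
  by move=> a0; apply: tends_ratio_seq => [p|]; [exact: ltW | exact: tends_cst].
set c := eta / (1 - vartheta).
have c0 : 0 < c by rewrite divr_gt0 // subr_gt0.
split=> [p|]; first by split.
split=> [p /=|]; rewrite -/c.
  have p0 : 0 <= p%:R :> R by [].
  have q0 : 0 < p%:R + (c + 1) by lra.
  by rewrite divr_gt0 // ltr_pdivrMr // mul1r; lra.
have hk := cst _ v0; have h := tends_natV R.
split; [exact: hk | | exact: cst | exact: tends_ratio_seq | exact: cst].
change (tends (fun p => (p%:R - (ratio_seq R (fun=> vartheta) p)%:R) *
  (c / (p%:R + (c + 1)))) eta).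
apply: (@tends_near_eq _ (fun p =>
  (1 - (ratio_seq R (fun=> vartheta) p)%:R / p%:R) *
  (c / (1 + (c + 1) * p%:R^-1)))).
- by lim; rewrite mulr0 addr0 oner_eq0.
- by rewrite mulr0 addr0 divr1 /c; field; lra.
by apply: filterS (near_nat_gt0 R) => p p0; field; lra.
Qed.

(* Diagonal argument: if the gain is eventually negative at each limit ratio
   [x j], letting [j] grow slowly with [p] gives one admissible sequence with
   limit ratio [lim x] along which the gain is eventually negative. *)
Lemma not_gain_pos_limit (x : nat -> R) (rhom : R) :
  (forall j, 0 <= x j) -> tends x rhom ->
  (forall j s, admissible vartheta eta rhoT (x j) rhoS s -> eventually_neg s) ->
  ~ gain_pos vartheta eta rhoT rhom rhoS.
Proof.
move=> x0 xa xneg gp.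
have H j : {P : nat | forall p, (P <= p)%N -> gain (model_of (fun=> x j)) p < 0}.
  apply: cid.
  have [P _ hP] := xneg j _ (admissible_model_of (fun=> x j) (x j)
    (fun=> x0 j) (tends_cst _ _)).
  by exists P => p; exact: hP.
pose P j := sval (H j).
(* The largest index [j <= p] whose threshold [P j] has been passed. It tends to infinity, since [A]
   qualifies once [p] exceeds both [A] and [P A]. *)
pose J p := (\max_(j < p.+1 | (P j <= p)%N) j)%N.
have Jge A p : (A <= p)%N -> (P A <= p)%N -> (A <= J p)%N.
  move=> Ap PA; have Ap' : (A < p.+1)%N by [].
  exact: (@leq_bigmax_cond _ _ (fun j : 'I_p.+1 => j : nat) (Ordinal Ap')).
(* The hypothesis on [P 0] covers the value 0 of an empty maximum. *)
have PJ p : (P 0%N <= p)%N -> (P (J p) <= p)%N.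
  by move=> P0; rewrite /J; apply: (big_ind (fun i => (P i <= p)%N)) => // i j;
    rewrite /maxn; case: ifP.
have Jinf : J p @[p --> \oo] --> \oo.
  apply/cvgnyPge => A; exists (maxn A (P A)) => // p /=.
  by rewrite geq_max => /andP[]; exact: Jge.
have xJ : tends (x \o J) rhom by exact: cvg_comp Jinf xa.
have /eventually_neg_not_pos := gp _ (admissible_model_of (x \o J) rhom
  (fun p => x0 (J p)) xJ).
(* At rank [p] the models of [x \o J] and of the constant [x (J p)] coincide, because [ratio_seq]
   reads its argument only at [p]. *)
apply; exists (P 0%N) => // p /= /PJ; exact: (svalP (H (J p))).
Qed.

(** Negativity on one side of [rhom] suffices; [y] bounds that side, and the disjunction covers both
    orders. *)
Lemma not_gain_pos_endpoint (y rhom : R) :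
  0 <= y -> 0 <= rhom ->
  (forall x s, (rhom < x < y) || (y < x < rhom) ->
     admissible vartheta eta rhoT x rhoS s -> eventually_neg s) ->
  y != rhom -> ~ gain_pos vartheta eta rhoT rhom rhoS.
Proof.
move=> y0 r0 xneg yr.
(* The factor 1/2 keeps [x 0] strictly short of [y]. *)
pose x j : R := rhom + (y - rhom) / 2 * j.+1%:R^-1.
have xin j : (rhom < x j < y) || (y < x j < rhom).
  have j0 : 0 < (j.+1%:R : R)^-1 by rewrite invr_gt0.
  have j1 : (j.+1%:R : R)^-1 <= 1 by rewrite invf_le1 ?ler1n.
  rewrite /x; set h := _^-1 in j0 j1 *.
  by case: (ltrgtP y rhom) yr => // yr _; apply/orP; [right|left];
     apply/andP; split; nra.
apply: (not_gain_pos_limit x).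
- by move=> j; case/orP: (xin j) => /andP[h1 h2]; lra.
- have h : tends (fun j => j.+1%:R^-1 : R) 0 := cvg_harmonic.
  by apply: tends_eq; [rewrite /x; lim | rewrite mulr0 addr0].
- by move=> j s; exact: xneg.
Qed.

End Approximation.

(** * Signs of the limits *)

Section Sign.
Context {R : realType} (vartheta eta rhoT rhoS : R).
Context (hvartheta : 0 < vartheta < 1) (hrhoT : 0 < rhoT < 1) (heta : 0 < eta).
Context (hrhoS : 0 < rhoS) (hTtheta : rhoT != vartheta).

Let adm x s := admissible vartheta eta rhoT x rhoS s.
Let Lambda := LambdaT vartheta rhoT.
Let sample_sign (x : R) :=
  linDE vartheta rhoT rhoS * x - 2 * x ^+ 2 - 2 * vartheta * rhoS.
Let feature_sign (x : R) :=
  (rhoS - vartheta - Lambda) * x - 2 * rhoS * (rhoS - vartheta).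

Let v0 : 0 < vartheta. Proof. by case/andP: hvartheta. Qed.
Let rT0 : 0 < rhoT. Proof. by case/andP: hrhoT. Qed.

Lemma sample_pos (x : R) (s : model_seq R) : vartheta < x < Num.min 1 rhoS ->
  0 < sample_sign x -> adm x s -> eventually_pos s.
Proof.
rewrite lt_min => /and3P[vx x1 xS] hx hs.
have vx1 : vartheta < x < 1 by rewrite vx.
have x0 := lt_trans v0 vx.
have [c c0 L] :=
  gain_sample_limit _ _ _ _ _ hvartheta hrhoT heta x0 hrhoS hTtheta _ hs vx1 xS.
exact: scaled_limit_pos L (mulr_gt0 c0 hx).
Qed.

Lemma sample_neg (x : R) (s : model_seq R) : vartheta < x < Num.min 1 rhoS ->
  sample_sign x < 0 -> adm x s -> eventually_neg s.
Proof.
rewrite lt_min => /and3P[vx x1 xS] hx hs.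
have vx1 : vartheta < x < 1 by rewrite vx.
have x0 := lt_trans v0 vx.
have [c c0 L] :=
  gain_sample_limit _ _ _ _ _ hvartheta hrhoT heta x0 hrhoS hTtheta _ hs vx1 xS.
by apply: scaled_limit_neg L _; rewrite pmulr_rlt0.
Qed.

Lemma feature_pos (x : R) (s : model_seq R) : vartheta < rhoS < Num.min 1 x ->
  0 < feature_sign x -> adm x s -> eventually_pos s.
Proof.
rewrite lt_min => /and3P[vS S1 Sx] hx hs.
have vS1 : vartheta < rhoS < 1 by rewrite vS.
have x0 := lt_trans hrhoS Sx.
have [c c0 L] :=
  gain_feature_limit _ _ _ _ _ hvartheta hrhoT heta x0 hrhoS hTtheta _ hs vS1 Sx.
exact: scaled_limit_pos L (mulr_gt0 c0 hx).
Qed.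

Lemma feature_neg (x : R) (s : model_seq R) : vartheta < rhoS < Num.min 1 x ->
  feature_sign x < 0 -> adm x s -> eventually_neg s.
Proof.
rewrite lt_min => /and3P[vS S1 Sx] hx hs.
have vS1 : vartheta < rhoS < 1 by rewrite vS.
have x0 := lt_trans hrhoS Sx.
have [c c0 L] :=
  gain_feature_limit _ _ _ _ _ hvartheta hrhoT heta x0 hrhoS hTtheta _ hs vS1 Sx.
by apply: scaled_limit_neg L _; rewrite pmulr_rlt0.
Qed.

(** Approximating from [vartheta] keeps the ratios in the sample-bottleneck range; the right-hand
    version approximates from [Num.min 1 rhoS]. *)
Lemma sample_not_pos_left (x : R) : vartheta < x < Num.min 1 rhoS ->
  (forall y, vartheta < y < x -> sample_sign y < 0) ->
  ~ gain_pos vartheta eta rhoT x rhoS.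
Proof.
move=> /andP[vx xM] hneg.
apply: (not_gain_pos_endpoint _ _ _ _ hvartheta heta rT0 hrhoS vartheta) => //.
- exact: ltW.
- exact/ltW/(lt_trans v0).
- move=> y s /orP[/andP[h1 h2]|h].
    by have := lt_trans h1 h2; rewrite ltNge ltW.
  apply: sample_neg; last exact: hneg.
  by case/andP: h => -> /lt_trans; apply.
- by rewrite lt_eqF.
Qed.

Lemma sample_not_pos_right (x : R) : vartheta < x < Num.min 1 rhoS ->
  (forall y, x < y < Num.min 1 rhoS -> sample_sign y < 0) ->
  ~ gain_pos vartheta eta rhoT x rhoS.
Proof.
move=> /andP[vx xM] hneg.
have x0 := lt_trans v0 vx.
apply: (not_gain_pos_endpoint _ _ _ _ hvartheta heta rT0 hrhoS
  (Num.min 1 rhoS)) => //.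
- exact/ltW/(lt_trans x0).
- exact: ltW.
- move=> y s /orP[h|/andP[h1 h2]]; last first.
    by have := lt_trans h1 h2; rewrite ltNge ltW.
  apply: sample_neg; last exact: hneg.
  by case/andP: h => h1 ->; rewrite (lt_trans vx).
- by rewrite gt_eqF.
Qed.

Lemma feature_not_pos (x : R) : vartheta < rhoS < Num.min 1 x ->
  (forall y, rhoS < y < x -> feature_sign y < 0) ->
  ~ gain_pos vartheta eta rhoT x rhoS.
Proof.
rewrite lt_min => /and3P[vS S1 Sx] hneg.
apply: (not_gain_pos_endpoint _ _ _ _ hvartheta heta rT0 hrhoS rhoS) => //.
- exact: ltW.
- exact/ltW/(lt_trans hrhoS).
- move=> y s /orP[/andP[h1 h2]|h].
    by have := lt_trans h1 h2; rewrite ltNge ltW.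
  apply: feature_neg; last exact: hneg.
  by case/andP: h => h _; rewrite lt_min vS S1.
- by rewrite lt_eqF.
Qed.

(** [rhom_lo] and [rhom_hi] are the roots of this concave quadratic. *)
Lemma sample_signE (x : R) : 0 <= DeltaDE vartheta rhoT rhoS ->
  sample_sign x =
  2 * (x - rhom_lo vartheta rhoT rhoS) * (rhom_hi vartheta rhoT rhoS - x).
Proof.
move=> D0; rewrite /rhom_lo /rhom_hi; set d := Num.sqrt _.
have : d ^+ 2 = DeltaDE vartheta rhoT rhoS by rewrite sqr_sqrtr.
rewrite /DeltaDE /sample_sign; set L := linDE _ _ _ => dE.
by lra.
Qed.

(** For [DeltaDE <= 0] this form shows negativity everywhere, except possibly at the vertex
    [linDE / 4]. *)
Lemma sample_sign_sqr (x : R) :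
  sample_sign x = DeltaDE vartheta rhoT rhoS / 8
                  - 2 * (x - linDE vartheta rhoT rhoS / 4) ^+ 2.
Proof. by rewrite /sample_sign /DeltaDE; field. Qed.

(** The constant term is negative, so positivity at some [x > 0] forces a positive slope, by which
    one may then divide. *)
Lemma feature_sign_gt0 (x : R) : vartheta < rhoS -> 0 < x ->
  0 < feature_sign x <->
  Lambda < rhoS - vartheta /\ rhom_crit vartheta rhoT rhoS < x.
Proof.
move=> vS x0; rewrite /feature_sign /rhom_crit -/Lambda.
have r0 : 0 < 2 * rhoS * (rhoS - vartheta) by rewrite !mulr_gt0 // subr_gt0.
split=> [h|[]]; last first.
  rewrite -subr_gt0 => rL.
  by rewrite ltr_pdivrMr // [x * _]mulrC -subr_gt0.
have rL : 0 < rhoS - vartheta - Lambda.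
  by rewrite -(pmulr_lgt0 _ x0) (lt_trans r0) // -subr_gt0.
split; first by rewrite -subr_gt0.
by rewrite ltr_pdivrMr // [x * _]mulrC -subr_gt0.
Qed.

End Sign.

(** In (ii) and (iii), the statements about each single sequence exclude the ratios where the
    first-order limit vanishes; those about [gain_pos] include them. *)
Theorem theorem5p4 (R : realType) (vartheta eta rhoT rhom rhoS : R)
  (hvartheta : 0 < vartheta < 1) (hrhoT : 0 < rhoT < 1) (heta : 0 < eta)
  (hrhom : 0 < rhom) (hrhoS : 0 < rhoS)
  (hTtheta : rhoT <> vartheta) (hmS : rhom <> rhoS)
  (hmtheta : rhom <> vartheta) (hStheta : rhoS <> vartheta)
  (hm1 : rhom <> 1) (hS1 : rhoS <> 1) :
  (* (i) *)
  (Num.min rhom rhoS < vartheta ->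
     forall s : model_seq R, admissible vartheta eta rhoT rhom rhoS s ->
       eventually_neg s)
  /\
  (* (ii) *)
  (vartheta < rhom < Num.min 1 rhoS ->
     (0 < DeltaDE vartheta rhoT rhoS ->
        (gain_pos vartheta eta rhoT rhom rhoS <->
           rhom_lo vartheta rhoT rhoS < rhom < rhom_hi vartheta rhoT rhoS
           /\ vartheta < rhom < Num.min 1 rhoS)
        /\
        (rhom <> rhom_lo vartheta rhoT rhoS ->
         rhom <> rhom_hi vartheta rhoT rhoS ->
         forall s : model_seq R, admissible vartheta eta rhoT rhom rhoS s ->
           (eventually_pos s <->
              rhom_lo vartheta rhoT rhoS < rhom < rhom_hi vartheta rhoT rhoS
              /\ vartheta < rhom < Num.min 1 rhoS)))
     /\
     (DeltaDE vartheta rhoT rhoS <= 0 ->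
        forall x : R, vartheta < x < Num.min 1 rhoS ->
          ~ gain_pos vartheta eta rhoT x rhoS
          /\
          (DeltaDE vartheta rhoT rhoS < 0 \/ x <> linDE vartheta rhoT rhoS / 4 ->
           forall s : model_seq R, admissible vartheta eta rhoT x rhoS s ->
             ~ eventually_pos s)))
  /\
  (* (iii) *)
  (vartheta < rhoS < Num.min 1 rhom ->
     (gain_pos vartheta eta rhoT rhom rhoS <->
        LambdaT vartheta rhoT < rhoS - vartheta
        /\ rhom_crit vartheta rhoT rhoS < rhom)
     /\
     (~ (LambdaT vartheta rhoT < rhoS - vartheta
         /\ rhom = rhom_crit vartheta rhoT rhoS) ->
      forall s : model_seq R, admissible vartheta eta rhoT rhom rhoS s ->
        (eventually_pos s <->
           LambdaT vartheta rhoT < rhoS - vartheta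
           /\ rhom_crit vartheta rhoT rhoS < rhom))).
Proof.
have Tv : rhoT != vartheta by exact/eqP.
have v0 : 0 < vartheta by case/andP: hvartheta.
have spos := sample_pos vartheta eta rhoT rhoS hvartheta hrhoT heta hrhoS Tv.
have sneg := sample_neg vartheta eta rhoT rhoS hvartheta hrhoT heta hrhoS Tv.
have fpos := feature_pos vartheta eta rhoT rhoS hvartheta hrhoT heta hrhoS Tv.
have fneg := feature_neg vartheta eta rhoT rhoS hvartheta hrhoT heta hrhoS Tv.
have sleft :=
  sample_not_pos_left vartheta eta rhoT rhoS hvartheta hrhoT heta hrhoS Tv.
have sright :=
  sample_not_pos_right vartheta eta rhoT rhoS hvartheta hrhoT heta hrhoS Tv.
have fnot := feature_not_pos vartheta eta rhoT rhoS hvartheta hrhoT heta hrhoS Tv.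
have sE := sample_signE vartheta rhoT rhoS.
have sD := sample_sign_sqr vartheta rhoT rhoS.
have fE := feature_sign_gt0 vartheta rhoT rhoS hrhoS.
split; last split.
- move=> lt_v s hs; have [mS|Sm|//] := ltgtP rhom rhoS.
    rewrite (min_l (ltW mS)) in lt_v.
    exact: (gain_sample_below _ _ _ _ _ hvartheta hrhoT heta hrhom hrhoS Tv _ hs).
  rewrite (min_r (ltW Sm)) in lt_v.
  exact: (gain_feature_below _ _ _ _ _ hvartheta hrhoT heta hrhom hrhoS Tv _ hs).
- move=> hm; split=> [D0|D0 x hx].
    have lohi : rhom_lo vartheta rhoT rhoS < rhom_hi vartheta rhoT rhoS.
      have : 0 < Num.sqrt (DeltaDE vartheta rhoT rhoS) by rewrite sqrtr_gt0.
      by rewrite /rhom_lo /rhom_hi; lra.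
    have {}sE x := sE x (ltW D0).
    set lo := rhom_lo _ _ _ in sE lohi *; set hi := rhom_hi _ _ _ in sE lohi *.
    have inpos : lo < rhom < hi ->
        forall s, admissible vartheta eta rhoT rhom rhoS s -> eventually_pos s.
      move=> /andP[h1 h2] s; apply: spos => //.
      by rewrite sE !mulr_gt0 // subr_gt0.
    split; last first.
      move=> /eqP nlo /eqP nhi s hs; split=> [sp|[h _]]; last exact: inpos.
      split=> //; apply/negP => /negP out.
      apply: eventually_neg_not_pos sp; apply: (sneg rhom) => //; rewrite sE.
      move: out; rewrite negb_and -!leNgt => /orP[]; rewrite le_eqVlt.
        by rewrite (negbTE nlo) /= => h; nra.
      by rewrite eq_sym (negbTE nhi) /= => h; nra.
    split=> [gp|[h _]]; last exact: inpos.
    (* Approximation moves away from the interval: strictly left of [lo] or right of [hi] the sign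
       is negative, even if [rhom] is itself a root. *)
    split=> //; apply: contrapT => /negP; rewrite negb_and -!leNgt => /orP[h|h].
      by apply: (sleft rhom hm _ gp) => y /andP[_ hy]; rewrite sE; nra.
    by apply: (sright rhom hm _ gp) => y /andP[hy _]; rewrite sE; nra.
  split.
    (* Approaching [x] from the side away from the vertex makes the square strictly positive. *)
    have [h|h] := leP x (linDE vartheta rhoT rhoS / 4).
      by apply: sleft => // y /andP[_ hy]; rewrite sD; nra.
    by apply: sright => // y /andP[hy _]; rewrite sD; nra.
  move=> hD s hs; apply: eventually_neg_not_pos; apply: (sneg x) => //; rewrite sD.
  case: hD => [h|/eqP h].
    by have := sqr_ge0 (x - linDE vartheta rhoT rhoS / 4); lra.
  have : 0 < (x - linDE vartheta rhoT rhoS / 4) ^+ 2.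
    by rewrite exprn_even_gt0 //= subr_eq0.
  by lra.
- move=> hS; have := hS; rewrite lt_min => /and3P[vS _ Sm].
  have pm := fE rhom vS hrhom.
  split.
    split=> [gp|/pm h s]; last exact: fpos.
    apply/pm; rewrite ltNge; apply/negP => h.
    (* The affine sign is negative at 0; if it were nonnegative at [y] with [0 < y < rhom], it would
       be positive at [rhom]. *)
    apply: (fnot rhom hS _ gp) => y /andP[Sy ym].
    rewrite ltNge; apply/negP => h'.
    have r0 : 0 < 2 * rhoS * (rhoS - vartheta) by rewrite !mulr_gt0 // subr_gt0.
    by nra.
  move=> ncrit s hs; split=> [sp|/pm h]; last exact: (fpos rhom).
  apply/pm; rewrite ltNge; apply/negP => h.
  apply: eventually_neg_not_pos sp; apply: (fneg rhom) => //.
  (* A vanishing sign at [rhom > 0] forces a positive slope and [rhom = rhom_crit], the excluded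
     case. *)
  rewrite lt_neqAle h andbT; apply/negP => /eqP h0; apply: ncrit.
  have r0 : 0 < 2 * rhoS * (rhoS - vartheta) by rewrite !mulr_gt0 // subr_gt0.
  have L0 : 0 < rhoS - vartheta - LambdaT vartheta rhoT.
    by rewrite -(pmulr_lgt0 _ hrhom); lra.
  split; first by rewrite -subr_gt0.
  apply: (mulIf (lt0r_neq0 L0)); rewrite /rhom_crit divfK ?gt_eqF //.
  by lra.
Qed.
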